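(* Let $Z$ be an infinite dimensional separable Banach space viewed as a (Polish) group under addition. Then there exists a Polish $Z$-space $X$ whose associated orbit equivalence relation $E^Z_X$ is Borel and not essentially countable.
   Context: For a Polish group $G$, a Polish $G$-space is a Polish space $X$ together with a continuous action $G\times X\to X$. The orbit equivalence relation $E^G_X$ is defined by $x\,E^G_X\,x'$ if and only if $x$ and $x'$ have the same $G$-orbit; it is Borel if it is a Borel subset of $X\times X$. For analytic equivalence relations $E$, $F$ on standard Borel spaces $X$, $Y$, $E\leq_B F$ means that there is a Borel map $f\colon X\to Y$ such that $x\,E\,x' \iff f(x)\,F\,f(x')$ for all $x,x'\in X$. A Borel equivalence relation is countable if each of its classes is countable. $E$ is essentially countable if $E\leq_B F$ for some countable Borel equivalence relation $F$ (on a standard Borel space). *)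

(* Defs.v *)
From mathcomp Require Import all_boot all_order all_algebra.
From mathcomp Require Import all_classical all_reals all_analysis.
From Stdlib Require Import RelationClasses.

Set Implicit Arguments.
Unset Strict Implicit.
Unset Printing Implicit Defensive.

Import Order.TTheory GRing.Theory Num.Theory.
Import numFieldNormedType.Exports.

Local Open Scope classical_set_scope.
Local Open Scope ring_scope.

Definition separable (T : topologicalType) : Prop :=
  exists2 A : set T, countable A & dense A.

Definition complete_metric (R : realType) (M : metricType R) : Prop :=
  forall F : set_system M, ProperFilter F -> cauchy F ->
    exists x : M, F --> x.

(* The compatible complete metric is carried by a homeomorphic copy of T. *)
Definition completely_metrizable (R : realType) (T : topologicalType) : Prop :=
  exists (M : metricType R) (f : T -> M) (g : M -> T),
    [/\ cancel f g, cancel g f, continuous f, continuous g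
      & complete_metric M].

(* R is only the codomain of the metric: all real types are isomorphic, so the
   notion does not depend on it. *)
Definition polish_space (R : realType) (T : topologicalType) : Prop :=
  separable T /\ completely_metrizable R T.

Definition borel_set (T : topologicalType) : set (set T) := <<s @open T >>.

Definition borelType (T : ptopologicalType) := g_sigma_algebraType (@open T).

Definition standard_borel (R : realType) (d : measure_display)
    (Y : measurableType d) : Prop :=
  exists (P : topologicalType) (f : Y -> P),
    [/\ polish_space R P, bijective f
      & (measurable : set (set Y)) = [set f @^-1` B | B in @borel_set P]].

Definition countable_borel_equivalence (d : measure_display)
    (Y : measurableType d) (F : Y -> Y -> Prop) : Prop :=
  [/\ Equivalence F,
      measurable [set p : Y * Y | F p.1 p.2]
    & forall y, countable [set y' | F y y']].

Definition borel_reducible (d d' : measure_display)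
    (X : measurableType d) (Y : measurableType d')
    (E : X -> X -> Prop) (F : Y -> Y -> Prop) : Prop :=
  exists2 f : X -> Y,
    measurable_fun setT f & forall x x', E x x' <-> F (f x) (f x').

Definition essentially_countable (R : realType) (d : measure_display)
    (X : measurableType d) (E : X -> X -> Prop) : Prop :=
  exists (d' : measure_display) (Y : measurableType d') (F : Y -> Y -> Prop),
    [/\ standard_borel R Y, countable_borel_equivalence F
      & borel_reducible E F].

Definition polish_Gspace (R : realType) (G : topologicalZmodType)
    (X : topologicalType) (act : G -> X -> X) : Prop :=
  [/\ polish_space R X,
      forall x, act 0 x = x,
      forall g h x, act (g + h) x = act g (act h x)
    & continuous (fun p : G * X => act p.1 p.2)].

Definition group_orbit (G X : Type) (act : G -> X -> X) (x : X) : set X :=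
  [set act g x | g in [set: G]].

Definition orbit_equivalence (G X : Type) (act : G -> X -> X) (x x' : X) : Prop :=
  group_orbit act x = group_orbit act x'.

Definition infinite_dimensional (K : fieldType) (V : lmodType K) : Prop :=
  ~ exists (n : nat) (e : 'I_n -> V),
      forall v, exists c : 'I_n -> K, v = \sum_(i < n) c i *: e i.

(* Main.v *)
Require Import Defs.
From HB Require Import structures.
From mathcomp Require Import all_boot all_order all_algebra.
From mathcomp Require Import all_classical all_reals all_analysis.
From mathcomp Require Import ring lra.

Set Implicit Arguments.
Unset Strict Implicit.
Unset Printing Implicit Defensive.

Import Order.TTheory GRing.Theory Num.Theory.
Import numFieldNormedType.Exports.

Local Open Scope classical_set_scope.
Local Open Scope ring_scope.

(** Embed [Z] by a compact operator into the bounded sequences and let it act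
    by translation on the closure [X] of its range: with functionals [phi n] of
    norm at most 1 such that [`|z|] is the supremum of [`|phi n z|], send [z] to
    the sequence [phi n z / 2 ^+ n], and close the range for the supremum norm.

    The orbit equivalence relation is Borel because the functionals are norming
    ([norming_family_exists], a consequence of the Hahn-Banach theorem). For the
    larger norm [sup_n 2 ^+ n * `|x n|] the embedding is an isometry, so its
    range is complete and a sequence belongs to it as soon as it is approximable,
    in that norm, by the images of a countable dense subset of [Z]. This
    condition on [y - x] is a countable combination of closed conditions
    ([translateP]).

    The action is turbulent. Orbits are dense by construction; they are meager
    because the common kernel of finitely many functionals contains arbitrarily
    long vectors, which are very short in [X] ([translate_orbits_meager]); and
    balls of [X] are convex, so that two points of an orbit lying in a ball are
    joined inside it by arbitrarily small steps of the action.

    Turbulence excludes a reduction [f] to a countable Borel equivalence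
    relation ([turbulent_not_essentially_countable]). Let the sets [B n] separate
    the points of the target, and let the open sets [V n] agree with their
    preimages on a comeager set. For generic [x], the function [f] takes only
    countably many values on the orbit of [x], so one of them is attained at
    [act z x] for comeagerly many [z] in some basic open set [U] of [Z]
    ([orbit_decided]). The same [U] works for a set of points [x] dense in some
    ball [C] of [X]. For each [n], whether [act z x] lies in [V n] for some [z]
    in [U] is unchanged when [x] moves by a small step, hence generically
    constant on [C] ([hits_all_or_nothing]). So any two generic points of [C]
    have translates with the same image under [f] ([pattern_equivalent]), and all
    of them lie in one orbit, which contradicts its meagerness. *)

(** * Baire category relative to an open set *)

Section Category.
Variable T : topologicalType.
Implicit Types (A D O V W : set T).

Definition baire_space :=
  forall F : nat -> set T,
    (forall i, open (F i) /\ dense (F i)) -> dense (\bigcap_i F i).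

(** For open [O] this says that [O] lies in the closure of [A]; quantifying over
    open subsets of [O] keeps arguments free of closures. *)
Definition dense_in O A :=
  forall W, open W -> W `<=` O -> W !=set0 -> W `&` A !=set0.

(** [D] is comeager in [O]. *)
Definition generic_in O D := exists G : nat -> set T,
  [/\ forall i, open (G i), forall i, dense_in O (G i)
    & O `&` \bigcap_i G i `<=` D].

Lemma dense_in_sub O O' A : O' `<=` O -> dense_in O A -> dense_in O' A.
Proof. by move=> sO dA W oW sW; apply: dA => //; apply: subset_trans sO. Qed.

Lemma dense_inW O A A' : A `<=` A' -> dense_in O A -> dense_in O A'.
Proof.
by move=> sA dA W oW sW nW; have [w [Ww /sA ?]] := dA _ oW sW nW; exists w.
Qed.

Lemma dense_inI O A V :
  open V -> dense_in O V -> dense_in O A -> dense_in O (A `&` V).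
Proof.
move=> oV dV dA W oW sW nW.
have [] := dA (W `&` V); first exact: openI.
- by move=> x [/sW].
- exact: dV.
by move=> x [[? ?] ?]; exists x.
Qed.

Lemma generic_in_open O V : open V -> dense_in O V -> generic_in O V.
Proof. by move=> oV dV; exists (fun=> V); split=> // x [_ /(_ 0%N Logic.I)]. Qed.

Lemma generic_in_sub O D D' : D `<=` D' -> generic_in O D -> generic_in O D'.
Proof. by move=> sD [G [oG dG sG]]; exists G; split=> // x /sG/sD. Qed.

Lemma generic_in_restrict O O' D :
  O' `<=` O -> generic_in O D -> generic_in O' D.
Proof.
move=> sO [G [oG dG sG]]; exists G; split=> [//|i|x [/sO Ox Gx]].
  exact: dense_in_sub (dG i).
exact: sG.
Qed.

Lemma generic_in_bigcap (I : countType) O (D : I -> set T) :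
  (forall i, generic_in O (D i)) -> generic_in O (\bigcap_i D i).
Proof.
move=> /choice[G GD].
exists (fun n => if @unpickle (I * nat)%type n is Some p then G p.1 p.2
                 else setT); split=> [n|n|x [Ox Gx] i _].
- case: unpickle => [[i k]|]; last exact: openT.
  by have [/(_ k)] := GD i.
- case: unpickle => [[i k]|]; first by have [_ /(_ k)] := GD i.
  by move=> W _ _ [x Wx]; exists x.
- have [_ _] := GD i; apply; split=> // k _.
  by have := Gx (pickle (i, k)) Logic.I; rewrite pickleK.
Qed.

Lemma generic_inI O D D' :
  generic_in O D -> generic_in O D' -> generic_in O (D `&` D').
Proof.
move=> gD gD'.
have gb (b : bool) : generic_in O (if b then D else D') by case: b.
apply: generic_in_sub (generic_in_bigcap gb) => x Dx.
by split; [exact: (Dx true)|exact: (Dx false)].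
Qed.

Lemma generic_in_all (I : countType) O (D : I -> set T) :
  (forall i, generic_in O (D i)) -> generic_in O [set x | forall i, D i x].
Proof.
by move=> /generic_in_bigcap; apply: generic_in_sub => x Dx i; exact: Dx.
Qed.

Hypothesis bT : baire_space.

(** Sets that are open and dense only in [O] become dense in the whole space
    once the interior of the complement of [O] is added to them. *)
Lemma generic_in_nonempty O D :
  open O -> O !=set0 -> generic_in O D -> O `&` D !=set0.
Proof.
move=> oO nO [G [oG dG sG]].
have odF i : open (G i `|` (~` O)°) /\ dense (G i `|` (~` O)°).
  split; first by apply: openU; [exact: oG|exact: open_interior].
  move=> W nW oW; have [WO|WO] := pselect (W `&` O !=set0).
    have oWO : open (W `&` O) by exact: openI.
    have sWO : W `&` O `<=` O by move=> ? [].
    by have [x [[Wx _] Gx]] := dG i _ oWO sWO WO; exists x; split=> //; left.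
  have [x Wx] := nW; exists x; split=> //; right.
  rewrite /interior; apply: (@filterS _ _ _ W); last exact: open_nbhs_nbhs.
  by move=> y Wy Oy; apply: WO; exists y.
have [x [Ox Gx]] := bT odF nO oO.
exists x; split=> //; apply: sG; split=> // i _.
by have [//|/interior_subset] := Gx i Logic.I.
Qed.

(** One of countably many sets covering a generic set is not nowhere dense:
    otherwise the generic points outside all of their closures would be
    uncovered. *)
Lemma generic_in_cover (I : countType) O D (A : I -> set T) :
  open O -> O !=set0 -> generic_in O D -> O `&` D `<=` \bigcup_i A i ->
  exists i V, [/\ open V, V !=set0, V `<=` O & dense_in V (A i)].
Proof.
move=> oO nO gD sD; apply: contrapT => none.
have gC i : generic_in O (~` A i)°.
  apply: generic_in_open; first exact: open_interior.
  move=> W oW sW nW; apply: contrapT => WA.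
  apply: none; exists i, W; split=> // W' oW' sW' nW'.
  apply: contrapT => W'A; have [x W'x] := nW'.
  apply: WA; exists x; split; first exact: sW'.
  rewrite /interior; apply: (@filterS _ _ _ W'); last exact: open_nbhs_nbhs.
  by move=> y W'y Ay; apply: W'A; exists y.
have [x [Ox [Dx Cx]]] :=
  generic_in_nonempty oO nO (generic_inI gD (generic_in_all gC)).
by have [i _ Aix] := sD x (conj Ox Dx); exact: interior_subset (Cx i) Aix.
Qed.

End Category.

(** Open sets have the Baire property, and it is inherited by complements since
    the complement of an open set is an open set up to its nowhere dense
    boundary. *)
Lemma borel_baire_property (T : topologicalType) (S : set T) :
  borel_set S ->
  exists2 V, open V & generic_in setT [set x | S x <-> V x].
Proof.
pose P := [set S : set T |
  exists2 V, open V & generic_in setT [set x | S x <-> V x]].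
have gT (D : set T) : setT `<=` D -> generic_in setT D.
  move=> sD; apply: generic_in_sub sD _.
  apply: generic_in_open; first exact: openT.
  by move=> W _ _ [x Wx]; exists x.
suff sP : <<s @open T >> `<=` P by move/sP.
apply: smallest_sub; last by move=> V oV; exists V => //; apply: gT.
split.
- by exists set0; [exact: open0|exact: gT].
- move=> A [V oV gV]; exists (~` V)°; first exact: open_interior.
  have gB : generic_in setT (V `|` (~` V)°).
    apply: generic_in_open; first by apply: openU => //; exact: open_interior.
    move=> W oW _ [w Ww]; have [[x [Wx Vx]]|WV] := pselect (W `&` V !=set0).
      by exists x; split=> //; left.
    exists w; split=> //; right.
    rewrite /interior; apply: (@filterS _ _ _ W); last exact: open_nbhs_nbhs.
    by move=> y Wy Vy; apply: WV; exists y.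
  apply: generic_in_sub (generic_inI gV gB) => x [/= AV [Vx|Vx]].
    split=> [[_ /(_ (AV.2 Vx))]//|/interior_subset//].
  split=> // _; split=> // Ax; exact: interior_subset Vx (AV.1 Ax).
- move=> A /(_ _)/cid2 AV; pose V n := s2val (AV n).
  exists (\bigcup_n V n); first by apply: bigcup_open => n _; exact: (s2valP (AV n)).
  have := generic_in_all (fun n => s2valP' (AV n)).
  apply: generic_in_sub => x /= AVx; split=> -[n _ xn]; exists n => //.
    exact: (AVx n).1.
  exact: (AVx n).2.
Qed.

(** * Turbulent actions of Banach spaces *)

Section Turbulence.
Variables (R : realType) (Z : completeNormedModType R) (X : topologicalType).
Variable act : Z -> X -> X.
Hypothesis act0 : forall x, act 0 x = x.
Hypothesis actD : forall g h x, act (g + h) x = act g (act h x).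
Hypothesis act_cont : continuous (fun p : Z * X => act p.1 p.2).

Variables (I K : countType) (U : I -> set Z).
Hypothesis Uopen : forall i, open (U i).
Hypothesis Unonempty : forall i, U i !=set0.
Hypothesis Ubase :
  forall O : set Z, open O -> O !=set0 -> exists i, U i `<=` O.

Lemma act_open_vector (x : X) (G : set X) : open G -> open [set z | G (act z x)].
Proof.
move=> oG; apply: (@open_comp _ _ (act^~ x)) => // z _.
apply: (@continuous_comp _ _ _ (fun z => (z, x)) (fun p => act p.1 p.2)).
  by apply: cvg_pair; [exact: cvg_id|exact: cvg_cst].
exact: act_cont.
Qed.

Lemma act_open_point (z : Z) (G : set X) : open G -> open [set x | G (act z x)].
Proof.
move=> oG; apply: (@open_comp _ _ (act z)) => // x _.
apply: (@continuous_comp _ _ _ (fun x => (z, x)) (fun p => act p.1 p.2)).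
  by apply: cvg_pair; [exact: cvg_cst|exact: cvg_id].
exact: act_cont.
Qed.

(** The saturation of [G] under the vectors of [- U i]. *)
Definition hits (G : set X) (i : I) := [set x | exists2 z, U i z & G (act z x)].

Lemma open_hits G i : open G -> open (hits G i).
Proof.
move=> oG; rewrite (_ : hits G i = \bigcup_(z in U i) [set x | G (act z x)]).
  by apply: bigcup_open => z _; exact: act_open_point.
by apply/seteqP; split=> x [z]; exists z.
Qed.

Lemma dense_hits G i : dense_in setT G -> dense_in setT (hits G i).
Proof.
move=> dG W oW _ [w Ww]; have [z Uz] := Unonempty i.
have [] := dG [set x | W (act (- z) x)].
- exact: act_open_point.
- by [].
- by exists (act z w); rewrite /= -actD addNr act0.
- move=> x [Wx Gx]; exists (act (- z) x); split=> //; exists z => //.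
  by rewrite -actD addrN act0.
Qed.

(** The direction of the Kuratowski-Ulam theorem that concerns orbits: for
    generic [x], the generic point of the orbit of [x] lies in [D]. *)
Lemma generic_along_orbits (D : set X) : generic_in setT D ->
  generic_in setT [set x | generic_in setT [set z | D (act z x)]].
Proof.
move=> [G [oG dG sG]].
have gG : generic_in setT [set x | forall p : nat * I, hits (G p.1) p.2 x].
  apply: generic_in_all => -[n i].
  by apply: generic_in_open; [exact: open_hits|exact: dense_hits].
apply: generic_in_sub gG => x Gx.
exists (fun n => [set z | G n (act z x)]); split.
- by move=> n; exact: act_open_vector.
- move=> n W oW _ nW; have [i UW] := Ubase oW nW.
  by have [z /UW Wz Gz] := Gx (n, i); exists z.
- by move=> z [_ Gz]; apply: sG; split=> // n _; exact: Gz.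
Qed.

(** For such [x] and every [n], the truth value of [V n (act z x)] is the same for
    generic [z] in [U i]. *)
Definition decided (V : K -> set X) (i : I) : set X := [set x | forall n,
  (forall z, U i z -> ~ V n (act z x)) \/ dense_in (U i) [set z | V n (act z x)]].

Hypothesis orbits_dense :
  forall x O, open O -> O !=set0 -> exists z, O (act z x).

(** Inside a convex open set, a segment joins two points of an orbit by
    arbitrarily small steps. From a decided point such a step cannot leave
    [hits (V n) i], because a small shift of [U i] still overlaps [U i]; since
    orbits are dense, a region met by [hits (V n) i] cannot contain a region
    avoiding it. *)
Lemma hits_all_or_nothing (V : K -> set X) (i : I) (O : set X) (n : K) :
  open (V n) -> open O ->
  (forall x z t, 0 <= t <= 1 -> O x -> O (act z x) -> O (act (t *: z) x)) ->
  dense_in O (decided V i) ->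
  O `&` hits (V n) i !=set0 -> dense_in O (hits (V n) i).
Proof.
move=> oV oO convO dA nOH W oW sW [x Wx]; apply: contrapT => WH.
set H := hits (V n) i in nOH WH.
have oH : open H by exact: open_hits.
have oOH : open (O `&` H) by exact: openI.
have [z [Oz Hz]] := orbits_dense x oOH nOH.
(* [N] is so large that the step [z / N] moves some point of [U i] inside it. *)
have [N /= N0 [u Uu UuN]] : exists2 N, (0 < N)%N &
    exists2 u, U i u & U i (u + N%:R^-1 *: z).
  have [u Uu] := Unonempty i.
  have /nbhs_ballP[e /= e0 eU] : nbhs u (U i) by exact: open_nbhs_nbhs.
  have [N zN] : exists N : nat, `|z| / e < N%:R.
    by exists (Num.truncn (`|z| / e)).+1; exact: truncnS_gt.
  exists N.+1 => //; exists u => //; apply: eU.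
  rewrite -ball_normE /= opprD addNKr normrN normrZ ger0_norm; last first.
    by rewrite invr_ge0.
  rewrite mulrC ltr_pdivrMr ?ltr0n// mulrC -ltr_pdivrMr//.
  by rewrite (lt_trans zN)// ltr_nat.
pose p (j : nat) := act ((j%:R / N%:R) *: z) x.
have Op j : (j <= N)%N -> O (p j).
  move=> jN; apply: convO => //; last exact: sW.
  rewrite divr_ge0//= ler_pdivrMr ?ltr0n// mul1r ler_nat//.
(* No step leads from outside the closure of [H] into it. *)
have : (~` H)° (p N).
  have : (N <= N)%N by [].
  elim: {1 3}N => [_|j IH jN].
    rewrite /p mul0r scale0r act0 /interior.
    apply: (@filterS _ _ _ W); last exact: open_nbhs_nbhs.
    by move=> y Wy Hy; apply: WH; exists y.
  apply: contrapT => far.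
  have pj : p j = act (- (N%:R^-1 *: z)) (p j.+1).
    rewrite /p -actD -scaleNr -scalerDl; congr (act (_ *: _) _).
    by rewrite -natr1 mulrDl mul1r addrC addrK.
  pose W' := [set y | (~` H)° (act (- (N%:R^-1 *: z)) y)] `&` O.
  have oW' : open W'.
    by apply: openI => //; apply: act_open_point; exact: open_interior.
  have W'p : W' (p j.+1).
    by split=> /=; [rewrite -pj; apply: IH; exact: ltnW|exact: Op].
  have W'H : W' `&` H !=set0.
    apply: contrapT => W'H; apply: far.
    apply: (@filterS _ _ _ W'); last exact: open_nbhs_nbhs.
    by move=> y W'y Hy; apply: W'H; exists y.
  have [|v [[[farv Ov] Hv] Av]] := dA _ (openI oW' oH) _ W'H.
    by move=> y [[]].
  have dv : dense_in (U i) [set s | V n (act s v)].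
    have [nothing|//] := Av n.
    by have [s Us Vs] := Hv; have := nothing s Us Vs.
  pose S := U i `&` [set s | U i (s + N%:R^-1 *: z)].
  have [|||s [[Us UsN] Vs]] := dv S.
  - apply: openI; first exact: Uopen.
    apply: (@open_comp _ _ (fun s => s + N%:R^-1 *: z)); last exact: Uopen.
    by move=> s _; apply: cvgD; [exact: cvg_id|exact: cvg_cst].
  - by move=> s [].
  - by exists u.
  - apply: (interior_subset farv); exists (s + N%:R^-1 *: z) => //.
    by rewrite -actD addrK.
by move=> /interior_subset; apply; rewrite /p divff ?scale1r// pnatr_eq0 -lt0n.
Qed.

Variables (Y : Type) (f : X -> Y) (F : Y -> Y -> Prop) (B : K -> set Y).
Hypothesis Fcountable : forall y, countable [set y' | F y y'].
Hypothesis fE : forall x x', (exists z, x' = act z x) <-> F (f x) (f x').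
Variable V : K -> set X.
Hypothesis Vopen : forall n, open (V n).

Let D := [set x | forall n, B n (f x) <-> V n x].

(** On an orbit [f] takes countably many values, so one of them is attained
    densely in some [U i]; that value decides every [V n] on [U i]. *)
Lemma orbit_decided (x : X) :
  generic_in setT [set z | D (act z x)] -> exists i, decided V i x.
Proof.
move=> Dx; have [code code_inj] := countable_injP _ (Fcountable (f x)).
have Ff z : F (f x) (f (act z x)) by apply/fE; exists z.
pose A n := [set z | D (act z x) /\ code (f (act z x)) = n].
have covA : [set: Z] `&` [set z | D (act z x)] `<=` \bigcup_n A n.
  by move=> z [_ Dz]; exists (code (f (act z x))).
have nZ : [set: Z] !=set0 by exists 0.
have [n [W [oW nW _ dW]]] :=
  generic_in_cover (@Baire R Z) openT nZ Dx covA.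
have [i UW] := Ubase oW nW; exists i => k.
have dU : dense_in (U i) (A n) := dense_in_sub UW dW.
have oVk : open [set z | V k (act z x)] := act_open_vector x (Vopen k).
have [[z0 [Uz0 Vz0]]|none] :=
  pselect (U i `&` [set z | V k (act z x)] !=set0); last first.
  by left=> z Uz Vz; apply: none; exists z.
right; have [|||z1 [[Uz1 Vz1] [Dz1 cz1]]] :=
  dU (U i `&` [set z | V k (act z x)]).
- by apply: openI => //; exact: Uopen.
- by move=> z [].
- by exists z0.
apply: dense_inW dU => z [Dz cz]; apply/(Dz k).
suff -> : f (act z x) = f (act z1 x) by apply/(Dz1 k).
by apply: code_inj; rewrite ?inE// cz cz1.
Qed.

Hypothesis Bsep : forall y y', (forall n, B n y <-> B n y') -> y = y'.

Definition pattern (i : I) (J : set K) : set X := [set x | forall n,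
  if `[< J n >] then dense_in (U i) [set z | V n (act z x)]
  else forall z, U i z -> ~ V n (act z x)].

(** A generic translation by a vector of [U i] sends both points into [D] and
    into the same sets [V n], hence to points with the same image under [f]. *)
Lemma pattern_equivalent (i : I) (J : set K) (x x' : X) :
  generic_in setT [set z | D (act z x)] ->
  generic_in setT [set z | D (act z x')] ->
  pattern i J x -> pattern i J x' -> exists z, x' = act z x.
Proof.
move=> Dx Dx' Ax Ax'.
have gV w n : pattern i J w ->
    generic_in (U i) [set z | V n (act z w) <-> J n].
  move=> Aw; case: (asboolP (J n)) (Aw n) => Jn Awn.
    apply: (@generic_in_sub _ _ [set z | V n (act z w)]) => //.
    by apply: generic_in_open => //; exact: act_open_vector.
  apply: (@generic_in_sub _ _ (U i)) => [z /Awn //|].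
  apply: generic_in_open; first exact: Uopen.
  by move=> W _ sW [w' Ww']; exists w'; split=> //; exact: sW.
have := generic_in_nonempty (@Baire R Z) (Uopen i) (Unonempty i)
  (generic_inI (generic_inI (generic_in_restrict (@subsetT _ _) Dx)
                            (generic_in_restrict (@subsetT _ _) Dx'))
    (generic_inI (generic_in_all (fun n => gV x n Ax))
                 (generic_in_all (fun n => gV x' n Ax')))).
move=> [z [_ [[Dz Dz'] [Vz Vz']]]].
have fzz' : f (act z x) = f (act z x').
  apply: Bsep => n; have := Dz n; have := Dz' n; have := Vz n; have := Vz' n.
  by move=> /=; tauto.
have : F (f (act z x)) (f (act z x')).
  by rewrite -fzz'; apply/fE; exists 0; rewrite act0.
move=> /fE[g gE]; exists (- z + (g + z)).
by rewrite actD actD -gE -actD addNr act0.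
Qed.

Hypothesis baireX : baire_space X.
Hypothesis genericD : generic_in setT D.
Hypothesis Xnonempty : [set: X] !=set0.
Hypothesis convex_base : forall O : set X, open O -> O !=set0 ->
  exists O', [/\ open O', O' !=set0, O' `<=` O & forall x z t,
    0 <= t <= 1 -> O' x -> O' (act z x) -> O' (act (t *: z) x)].
Hypothesis orbits_meager :
  forall x, generic_in setT [set x' | ~ exists z, x' = act z x].

(** All generic points of some open set share one pattern, hence lie in a single
    orbit, although that orbit is meager. *)
Lemma turbulent_contradiction : False.
Proof.
have gD' := generic_along_orbits genericD.
have covA : [set: X] `&` [set x | generic_in setT [set z | D (act z x)]]
    `<=` \bigcup_i decided V i.
  by move=> x [_ /orbit_decided[k Ax]]; exists k.
have [i [G1 [oG1 nG1 _ dG1]]] :=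
  generic_in_cover baireX openT Xnonempty gD' covA.
have [C [oC nC sC convC]] := convex_base oG1 nG1.
have dC := dense_in_sub sC dG1.
pose J := [set n | C `&` hits (V n) i !=set0].
have gA : generic_in C (pattern i J).
  apply: generic_in_all => n.
  case: asboolP => Jn; last first.
    apply: (@generic_in_sub _ _ C).
      by move=> x Ox z Uz Vz; apply: Jn; exists x; split=> //; exists z.
    apply: generic_in_open => // W _ sW [w Ww].
    by exists w; split=> //; exact: sW.
  have dH := hits_all_or_nothing (Vopen n) oC convC dC Jn.
  have dAH : dense_in C (decided V i `&` hits (V n) i).
    by apply: dense_inI => //; exact: open_hits.
  have gH : generic_in C [set x | forall k, U k `<=` U i -> hits (V n) k x].
    apply: generic_in_all => k; case: (pselect (U k `<=` U i)) => [kU|nkU].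
      apply: (@generic_in_sub _ _ (hits (V n) k)) => //.
      apply: generic_in_open; first exact: open_hits.
      apply: dense_inW dAH => x [Ax [z1 Uz1 Vz1]].
      have [none|dx] := Ax n; first by case: (none z1 Uz1 Vz1).
      have [z [Uz Vz]] := dx (U k) (Uopen k) kU (Unonempty k).
      by exists z.
    apply: (@generic_in_sub _ _ C) => [x _ kU|]; first by case: nkU.
    apply: generic_in_open => // W _ sW [w Ww].
    by exists w; split=> //; exact: sW.
  apply: generic_in_sub gH => x Hx W oW sW nW.
  have [k kW] := Ubase oW nW.
  have [z Uz Vz] := Hx k (subset_trans kW sW).
  by exists z; split=> //; exact: kW.
have gE := generic_inI gA (generic_in_restrict (@subsetT _ C) gD').
have [x0 [_ [Ax0 Dx0]]] := generic_in_nonempty baireX oC nC gE.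
have [x1 [_ [[Ax1 Dx1]]]] := generic_in_nonempty baireX oC nC
  (generic_inI gE (generic_in_restrict (@subsetT _ C) (orbits_meager x0))).
by apply; exact: (pattern_equivalent Dx0 Dx1 Ax0 Ax1).
Qed.

End Turbulence.

(** * Complete metric spaces *)

Section MetricSpace.
Variables (R : realType) (M : metricType R).

Lemma metric_open_subball (O : set M) (x : M) :
  open O -> O x -> exists2 e, 0 < e & forall y, mdist x y < e -> O y.
Proof.
move=> oO Ox; have /nbhs_ballP[e /= e0 eO] : nbhs x O by exact: open_nbhs_nbhs.
by exists e => // y xy; apply: eO; rewrite ballEmdist.
Qed.

Lemma metric_openP (O : set M) :
  (forall x, O x -> exists2 e, 0 < e & forall y, mdist x y < e -> O y) ->
  open O.
Proof.
move=> oO; rewrite openE => x /oO[e e0 eO].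
by apply/nbhs_ballP; exists e => //= y; rewrite ballEmdist; exact: eO.
Qed.

Lemma metric_ball_open (x : M) (e : R) : open [set y | mdist x y < e].
Proof.
apply: metric_openP => y /= xy; exists (e - mdist x y); first by rewrite subr_gt0.
by move=> z yz; rewrite (le_lt_trans (metric_triangle x y z))// -ltrBrDl.
Qed.

(** Nested closed balls of radii at most [1 / n.+1], the [n]-th inside [G n]. *)
Lemma complete_metric_baire : complete_metric M -> baire_space M.
Proof.
move=> Mc G oG W [w Ww] oW.
pose ok (n : nat) (p q : M * R) := [/\ 0 < q.2, q.2 <= n.+1%:R^-1
  & forall y, mdist q.1 y <= q.2 -> mdist p.1 y < p.2 /\ G n y].
have next (np : nat * (M * R)) : exists q, 0 < np.2.2 -> ok np.1 np.2 q.
  case: np => n [x r] /=; have [r0|] := ltP 0 r; last by exists (x, r).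
  have [oGn dGn] := oG n.
  have [||y [/= xy Gy]] := dGn [set y | mdist x y < r].
  - by exists x; rewrite /= mdistxx.
  - exact: metric_ball_open.
  have [e e0 eG] := metric_open_subball (openI (metric_ball_open x r) oGn)
    (conj xy Gy).
  exists (y, Num.min (e / 2) n.+1%:R^-1) => _; split => /=.
  - by rewrite lt_min divr_gt0//= invr_gt0.
  - by rewrite ge_min lexx orbT.
  - move=> z; rewrite le_min => /andP[yz _]; apply: eG.
    by rewrite (le_lt_trans yz)// ltr_pdivrMr// ltr_pMr// ltr1n.
have [step stepP] := choice next.
have [e0 e0_gt0 e0W] := metric_open_subball oW Ww.
pose s := fix s n := if n is m.+1 then step (m, s m) else (w, e0).
have s_gt0 n : 0 < (s n).2.
  by elim: n => //= n IH; have [] := stepP (n, s n) IH.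
have sP n : ok n (s n) (s n.+1) by exact: (stepP (n, s n) (s_gt0 n)).
have nested n k : mdist (s n.+1).1 (s (n.+1 + k)%N).1 <= (s n.+1).2.
  have sub m y : mdist (s m.+1).1 y <= (s m.+1).2 -> mdist (s m).1 y <= (s m).2.
    by have [_ _ H] := sP m => /H[/ltW].
  suff H y : mdist (s (n.+1 + k)%N).1 y <= (s (n.+1 + k)%N).2 ->
      mdist (s n.+1).1 y <= (s n.+1).2.
    by apply: H; rewrite mdistxx ltW.
  by elim: k => [|k IH]; rewrite ?addn0// addnS => /sub.
pose x n := (s n).1.
have [l xl] : exists l : M, x n @[n --> \oo] --> l.
  apply: (Mc (x n @[n --> \oo])); apply: cauchy_exP => e e_gt0.
  exists (x (Num.truncn e^-1).+1).
  exists (Num.truncn e^-1).+1 => // m /= nm.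
  rewrite /= ballEmdist /= -(subnKC nm).
  rewrite (le_lt_trans (nested _ _))//; have [_ + _] := sP (Num.truncn e^-1).
  move=> /le_lt_trans; apply.
  by rewrite invf_plt ?posrE// truncnS_gt.
have lball n : mdist (s n.+1).1 l <= (s n.+1).2.
  apply/ler_addgt0Pr => e e_gt0.
  have /xl [N _ HN] : nbhs l (ball l e) by exact: nbhsx_ballx.
  have := HN (n.+1 + N)%N (leq_addl _ _); rewrite /= ballEmdist /= metric_sym => h.
  rewrite (le_trans (metric_triangle _ (x (n.+1 + N)%N) _))//.
  by apply: lerD; [exact: nested|exact: ltW].
exists l; split.
  by apply: e0W; have [_ _ H] := sP 0%N; have [] := H l (lball 0%N).
by move=> n _; have [_ _ H] := sP n; have [] := H l (lball n).
Qed.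

End MetricSpace.

Lemma separable_dense_seq (T : topologicalType) (x0 : T) : separable T ->
  exists d : nat -> T, forall O, open O -> O !=set0 -> exists n, O (d n).
Proof.
move=> [A /countable_injP[code code_inj] dA].
exists (fun n => xget x0 [set a | A a /\ code a = n]) => O oO nO.
have [a [Oa Aa]] := dA O nO oO; exists (code a).
case: xgetP => [b _ [Ab cab]|/(_ a)]; last by case.
by have <- : a = b by apply: code_inj; rewrite ?inE.
Qed.

Lemma separable_normed_base (R : realType) (Z : normedModType R) :
  separable Z -> exists U : nat * nat -> set Z,
    [/\ forall i, open (U i), forall i, U i !=set0
      & forall O, open O -> O !=set0 -> exists i, U i `<=` O].
Proof.
move=> /(separable_dense_seq 0)[d dd].
exists (fun p => ball (d p.1) p.2.+1%:R^-1); split.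
- by move=> i; exact: ball_open.
- by move=> i; exists (d i.1); apply: ballxx; rewrite invr_gt0.
move=> O oO [x Ox].
have /nbhs_ballP[e /= e0 eO] : nbhs x O by exact: open_nbhs_nbhs.
pose k := Num.truncn (2 / e).
have ke : k.+1%:R^-1 < e / 2.
  by rewrite invf_plt ?posrE ?divr_gt0// invf_div truncnS_gt.
have [n xdn] : exists n, ball x k.+1%:R^-1 (d n).
  apply: dd; first exact: ball_open.
  by exists x; apply: ballxx; rewrite invr_gt0.
exists (n, k) => y /= dy; apply: eO; rewrite (splitr e).
by apply: ball_triangle (le_ball (ltW ke) xdn) (le_ball (ltW ke) dy).
Qed.

(** Balls of small radius around a dense sequence separate the points of a
    Polish space. *)
Lemma standard_borel_separating (R : realType) (d : measure_display)
    (Y : measurableType d) (y0 : Y) : standard_borel R Y ->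
  exists B : nat * nat -> set Y, (forall i, measurable (B i)) /\
    forall y y', (forall i, B i y <-> B i y') -> y = y'.
Proof.
move=> [P [f [[Psep [M [h [g [hK _ hc _ _]]]]] fb mE]]].
have [s ds] := separable_dense_seq (f y0) Psep.
have [finv fK _] := fb.
have oB i e : open (h @^-1` [set m | mdist (h (s i)) m < e]).
  by apply: open_comp => [x _|]; [exact: hc|exact: metric_ball_open].
exists (fun p => f @^-1` (h @^-1` [set m | mdist (h (s p.1)) m < p.2.+1%:R^-1])).
split=> [[i k]|y y' sep].
  by rewrite mE; eexists; last reflexivity; apply: sub_sigma_algebra; exact: oB.
apply: contrapT => yy'.
have D0 : 0 < mdist (h (f y)) (h (f y')).
  by rewrite mdist_gt0; apply/eqP => /(can_inj hK)/(can_inj fK).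
set D := mdist _ _ in D0.
pose k := Num.truncn (2 / D).
have kD : k.+1%:R^-1 < D / 2.
  by rewrite invf_plt ?posrE ?divr_gt0// invf_div truncnS_gt.
have [n /= yn] : exists n,
    (h @^-1` [set m | mdist (h (f y)) m < k.+1%:R^-1]) (s n).
  apply: ds; first by apply: open_comp => [x _|]; [exact: hc|exact: metric_ball_open].
  by exists (f y); rewrite /= mdistxx invr_gt0.
have /= [+ _] := sep (n, k); rewrite metric_sym => /(_ yn) y'n.
have := metric_triangle (h (f y)) (h (s n)) (h (f y')).
rewrite -/D leNgt => /negP; apply; rewrite (splitr D).
by apply: ltrD; exact: lt_trans kD.
Qed.

(** * Turbulence excludes essential countability *)

Lemma orbit_equivalenceP (G : zmodType) (X : Type) (act : G -> X -> X) x x' :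
  (forall x, act 0 x = x) -> (forall g h x, act (g + h) x = act g (act h x)) ->
  orbit_equivalence act x x' <-> exists z, x' = act z x.
Proof.
move=> act0 actD; split=> [xx'|[z ->]].
  have : group_orbit act x' x' by exists 0.
  by rewrite -[group_orbit act x']xx' => -[z _ <-]; exists z.
rewrite /orbit_equivalence; apply/seteqP; split=> _ [g _ <-].
  by exists (g - z) => //; rewrite -actD subrK.
by exists (g + z) => //; rewrite actD.
Qed.

(** A standard Borel space has a countable separating family of Borel sets; the
    preimages of its members under a reduction are open up to meager sets, and
    these open sets are all that the category argument sees. *)
Theorem turbulent_not_essentially_countable (R : realType)
    (Z : completeNormedModType R) (X : ptopologicalType) (act : Z -> X -> X) :
  separable Z -> baire_space X ->
  (forall x, act 0 x = x) -> (forall g h x, act (g + h) x = act g (act h x)) ->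
  continuous (fun p : Z * X => act p.1 p.2) ->
  (forall x O, open O -> O !=set0 -> exists z, O (act z x)) ->
  (forall O : set X, open O -> O !=set0 ->
    exists O', [/\ open O', O' !=set0, O' `<=` O & forall x z t,
      0 <= t <= 1 -> O' x -> O' (act z x) -> O' (act (t *: z) x)]) ->
  (forall x, generic_in setT [set x' | ~ exists z, x' = act z x]) ->
  ~ essentially_countable R
      (orbit_equivalence act : borelType X -> borelType X -> Prop).
Proof.
move=> Zsep bX act0 actD actc odense convex omeager.
move=> [d [Y [F [Ystd [_ _ Fcount] [f mf fE]]]]].
have [U [oU nU Ubase]] := separable_normed_base Zsep.
have [B [mB Bsep]] := standard_borel_separating (f point) Ystd.
have bB i : borel_set (f @^-1` B i : set X).
  by rewrite -[f @^-1` _]setTI; exact: mf.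
pose V i := s2val (cid2 (borel_baire_property (bB i))).
have oV i : open (V i) by exact: (s2valP (cid2 (borel_baire_property (bB i)))).
have gV i : generic_in setT [set x | B i (f x) <-> V i x].
  exact: (s2valP' (cid2 (borel_baire_property (bB i)))).
apply: (turbulent_contradiction act0 actD actc oU nU Ubase odense Fcount _ oV
          Bsep bX (generic_in_all gV) _ convex omeager); last by exists point.
by move=> x x'; rewrite -(orbit_equivalenceP _ _ act0 actD).
Qed.

(** * Norming functionals *)

Section HahnBanach.
Variables (R : realType) (Z : normedModType R).
Implicit Types (q : Z -> R) (a x y : Z).

Definition sublinear q := [/\ forall x y, q (x + y) <= q x + q y,
  forall t x, 0 <= t -> q (t *: x) <= t * q x & forall x, q x <= `|x|].

Lemma sublinear0 q : sublinear q -> q 0 = 0.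
Proof.
case=> qD qZ _; apply/eqP; rewrite eq_le; apply/andP; split.
  by have := qZ 0 0 (lexx _); rewrite scale0r mul0r.
by have := qD 0 0; rewrite addr0 -subr_ge0 addrK.
Qed.

Lemma sublinear_oppr_ge q x : sublinear q -> - q (- x) <= q x.
Proof.
move=> sq; rewrite -subr_ge0 opprK; have [qD _ _] := sq.
by rewrite -(sublinear0 sq) -(addrN x).
Qed.

Lemma sublinear_norm_ge q x : sublinear q -> - `|x| <= q x.
Proof.
move=> sq; apply: le_trans (sublinear_oppr_ge x sq).
by rewrite lerN2 -(normrN x); have [_ _] := sq.
Qed.

Lemma sublinearZ q t x : sublinear q -> 0 <= t -> q (t *: x) = t * q x.
Proof.
move=> sq; rewrite le_eqVlt => /predU1P[<-|t0].
  by rewrite scale0r mul0r sublinear0.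
have [_ qZ _] := sq; apply/eqP; rewrite eq_le (qZ _ _ (ltW t0)) /=.
rewrite -ler_pdivlMl//; apply: le_trans (qZ _ _ _); last first.
  by rewrite invr_ge0 ltW.
by rewrite scalerA mulVf ?scale1r// gt_eqF.
Qed.

(** The witness is the largest sublinear minorant of [q] whose value at [- a] is
    at most [- q a]. It agrees with [q] at [a], hence is additive along [a]. *)
Lemma sublinear_additive_along q a : sublinear q ->
  exists q', [/\ sublinear q', forall x, q' x <= q x & q' (- a) <= - q a].
Proof.
move=> sq; have [qD qZ qn] := sq.
pose S x := [set q (x + t *: a) - t * q a | t in [set t | 0 <= t]].
have S0 x : S x !=set0 by exists (q (x + 0 *: a) - 0 * q a), 0 => //=.
have Slb x : has_lbound (S x).
  exists (- q (- x)) => _ [t /= t0 <-].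
  rewrite -(sublinearZ _ sq t0) lerBrDr addrC -lerBrDr opprK.
  by rewrite -{1}(addrK x (t *: a)) [t *: a + x]addrC qD.
have infS x t : 0 <= t -> inf (S x) <= q (x + t *: a) - t * q a.
  by move=> t0; apply: ge_inf => //; exists t.
have infSq x : inf (S x) <= q x.
  by have := infS x 0 (lexx _); rewrite scale0r addr0 mul0r subr0.
exists (fun x => inf (S x)); split=> //.
- split=> [x y|t x t0|x]; last exact: le_trans (infSq x) (qn x).
  + rewrite -lerBlDr; apply: lb_le_inf => // _ [s /= s0 <-].
    rewrite lerBlDr -lerBlDl; apply: lb_le_inf => // _ [t /= t0 <-].
    rewrite lerBlDl (le_trans (infS _ (s + t) _))//; first exact: addr_ge0.
    by rewrite addrACA -opprD -mulrDl lerD2r scalerDl addrACA qD.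
  + move: t0; rewrite le_eqVlt => /predU1P[<-|t0].
      by rewrite scale0r mul0r (le_trans (infSq _))// sublinear0.
    rewrite -ler_pdivrMl//; apply: lb_le_inf => // _ [s /= s0 <-].
    rewrite ler_pdivrMl// (le_trans (infS _ (t * s) _))//.
      by rewrite mulr_ge0 // ltW.
    rewrite -scalerA -scalerDr mulrBr mulrA lerB//.
    by apply: qZ; exact: ltW.
- have := infS (- a) 1 ler01.
  by rewrite scale1r addNr sublinear0// mul1r add0r.
Qed.

(** By Zorn's lemma there is a minimal sublinear functional below [q0], since the
    pointwise infimum of a chain of sublinear functionals is sublinear; being
    minimal, it is already additive along every vector. *)
Lemma linear_minorant q0 : sublinear q0 ->
  exists2 q, sublinear q /\ (forall x, q x <= q0 x) &
    forall x, q (- x) = - q x.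
Proof.
move=> sq0.
pose P q := sublinear q /\ forall x, q x <= q0 x.
pose T := {q | P q}.
pose below (r s : T) := `[< forall x, sval s x <= sval r x >].
have [||||q qmin] := @Zorn T below.
- by move=> r; apply/asboolP.
- move=> r s t /asboolP rs /asboolP st; apply/asboolP => x.
  exact: le_trans (st x) (rs x).
- move=> [r rP] [s sP] /asboolP rs /asboolP sr; apply: eq_exist => /=.
  by apply/funext => x; apply/eqP; rewrite eq_le rs sr.
- move=> A Atot; have [[r0 Ar0]|A0] := pselect (A !=set0); last first.
    by exists (exist P q0 (conj sq0 (fun=> lexx _))) => s As; case: A0; exists s.
  pose S x := [set sval r x | r in A].
  have S0 x : S x !=set0 by exists (sval r0 x), r0.
  have Slb x : has_lbound (S x).
    exists (- `|x|) => _ [r _ <-]; apply: sublinear_norm_ge.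
    by have [] := svalP r.
  have infS x r : A r -> inf (S x) <= sval r x.
    by move=> Ar; apply: ge_inf => //; exists r.
  have infP : sublinear (fun x => inf (S x)) /\ forall x, inf (S x) <= q0 x.
    split=> [|x]; last first.
      by apply: le_trans (infS x r0 Ar0) _; have [_] := svalP r0.
    split=> [x y|t x t0|x].
    + rewrite -lerBlDr; apply: lb_le_inf => // _ [r /= Ar <-].
      rewrite lerBlDr -lerBlDl; apply: lb_le_inf => // _ [s /= As <-].
      rewrite lerBlDl.
      have [rs|sr] : below r s \/ below s r by exact: Atot.
        have [[sD _ _] _] := svalP s.
        apply: le_trans (infS _ s As) (le_trans (sD _ _) _).
        by rewrite lerD2r; move/asboolP: rs; exact.
      have [[rD _ _] _] := svalP r.
      apply: le_trans (infS _ r Ar) (le_trans (rD _ _) _).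
      by rewrite lerD2l; move/asboolP: sr; exact.
    + move: t0; rewrite le_eqVlt => /predU1P[<-|t0].
        have [sr _] := svalP r0.
        by rewrite scale0r mul0r (le_trans (infS _ r0 Ar0))// (sublinear0 sr).
      rewrite -ler_pdivrMl//; apply: lb_le_inf => // _ [r /= Ar <-].
      rewrite ler_pdivrMl// (le_trans (infS _ r Ar))//.
      by have [[_ rZ _] _] := svalP r; apply: rZ; exact: ltW.
    + apply: le_trans (infS x r0 Ar0) _.
      by have [[_ _ +] _] := svalP r0; exact.
  by exists (exist P _ infP) => s As; apply/asboolP => x /=; exact: infS.
have [sq qq0] := svalP q; exists (sval q) => // x.
have [q' [sq' q'q q'x]] := sublinear_additive_along x sq.
have q'P : sublinear q' /\ forall x, q' x <= q0 x.
  by split=> // y; exact: le_trans (q'q y) (qq0 y).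
have qE : exist P q' q'P = q by apply: qmin; apply/asboolP.
apply/eqP; rewrite eq_le; apply/andP; split; first by rewrite -{1}qE.
by have := sublinear_oppr_ge (- x) sq; rewrite opprK.
Qed.

(** Starting from the norm made additive along [x], the minorant cannot drop
    below the norm at [x]. *)
Lemma norming_functional x :
  exists2 phi : {scalar Z}, forall y, `|phi y| <= `|y| & phi x = `|x|.
Proof.
have snorm : sublinear (fun y => `|y|).
  split=> [y z|t y t0|//]; first exact: ler_normD.
  by rewrite normrZ ger0_norm.
have [q0 [sq0 _ q0x]] := sublinear_additive_along x snorm.
have [q [sq qq0] qN] := linear_minorant sq0; have [qD qZ qn] := sq.
have qDE y z : q (y + z) = q y + q z.
  apply/eqP; rewrite eq_le qD/= -lerBrDr -qN.
  by rewrite -{1}(addrK z y) qD.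
have qZE t y : q (t *: y) = t * q y.
  have [t0|/ltW t0] := leP 0 t; first exact: sublinearZ.
  by rewrite -[t]opprK scaleNr qN mulNr (sublinearZ _ sq)// oppr_ge0.
have qlin : linear_for *%R q by move=> t y z; rewrite qDE qZE.
pose phi := HB.pack_for {scalar Z} q (GRing.isLinear.Build R Z R *%R q qlin).
have qle y : q y <= `|y| by [].
exists phi => [y|] /=.
  by rewrite ler_norml qle andbT sublinear_norm_ge.
apply/eqP; rewrite eq_le qle/= -lerN2 -qN.
exact: le_trans (qq0 _) q0x.
Qed.

End HahnBanach.

(** Bundled, so that the type built from the functionals below can carry its
    metric structure canonically. *)
Record norming_family (R : realType) (Z : normedModType R) := NormingFamily {
  functional :> nat -> {scalar Z};
  functional_le : forall n z, `|functional n z| <= `|z|;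
  functional_norming :
    forall z c, (forall n, `|functional n z| <= c) -> `|z| <= c }.

(** Functionals norming the points of a dense sequence norm every vector, as all
    of them are 1-Lipschitz. *)
Lemma norming_family_exists (R : realType) (Z : normedModType R) :
  separable Z -> inhabited (norming_family Z).
Proof.
move=> /(separable_dense_seq 0)[d dd].
have /choice[phi phiP] : forall n, exists phi : {scalar Z},
    (forall y, `|phi y| <= `|y|) /\ phi (d n) = `|d n|.
  by move=> n; have [phi ? ?] := norming_functional (d n); exists phi.
constructor; apply: (@NormingFamily _ _ phi) => [n z|z c zc].
  by have [] := phiP n.
apply/ler_addgt0Pr => e e0.
have [n zn] : exists n, ball z (e / 2) (d n).
  apply: dd; first exact: ball_open.
  by exists z; apply: ballxx; rewrite divr_gt0.
move: zn; rewrite -ball_normE /= => zn.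
have [phin phid] := phiP n.
rewrite -(subrK (d n) z) (le_trans (ler_normD _ _))// -phid.
rewrite (_ : phi n (d n) = phi n z - phi n (z - d n)); last first.
  by rewrite linearB /= opprB addrC subrK.
rewrite addrCA [leRHS]addrC [leRHS]addrC lerD//.
  exact: le_trans (ler_norm _) (zc n).
rewrite (splitr e) lerD ?ltW//.
apply: le_lt_trans zn; apply: le_trans (phin _).
by rewrite -normrN ler_norm.
Qed.

(** * The uniform closure of a compact image of the Banach space *)

Section Hull.
Variables (R : realType) (Z : normedModType R) (phi : norming_family Z).

(** The weights [2 ^- n] make this embedding into the bounded sequences compact:
    it is injective, but its inverse is unbounded in infinite dimension. *)
Definition weighted (z : Z) (n : nat) : R := phi n z / 2 ^+ n.

(** The closure of the range of [weighted] for the supremum norm. *)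
Definition hull : set (nat -> R) := [set x | forall e, 0 < e ->
  exists z, forall n, `|x n - weighted z n| <= e].

Definition hull_type := {x | hull x}.

Lemma weightedD z z' n : weighted (z + z') n = weighted z n + weighted z' n.
Proof. by rewrite /weighted linearD mulrDl. Qed.

Lemma weightedB z z' n : weighted (z - z') n = weighted z n - weighted z' n.
Proof. by rewrite /weighted linearB mulrBl. Qed.

Lemma weightedZ t z n : weighted (t *: z) n = t * weighted z n.
Proof. by rewrite /weighted linearZ mulrA. Qed.

Lemma weighted0 n : weighted 0 n = 0.
Proof. by rewrite /weighted linear0 mul0r. Qed.

Lemma weighted_le_pow z n : `|weighted z n| <= `|z| / 2 ^+ n.
Proof.
rewrite /weighted normrM normfV normrX normr_nat ler_pM2r ?functional_le//.
Qed.

Lemma weighted_le z n : `|weighted z n| <= `|z|.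
Proof.
apply: le_trans (weighted_le_pow z n) _.
by rewrite ler_pdivrMr ?exprn_gt0// ler_peMr// exprn_ege1// ler1n.
Qed.

Lemma hull_weighted z : hull (weighted z).
Proof. by move=> e e0; exists z => n; rewrite subrr normr0 ltW. Qed.

Lemma hull_translate z x : hull x -> hull (fun n => x n + weighted z n).
Proof.
move=> hx e /hx[z' z'P]; exists (z' + z) => n.
by rewrite weightedD opprD addrACA subrr addr0.
Qed.

HB.instance Definition _ := gen_eqMixin hull_type.
HB.instance Definition _ := gen_choiceMixin hull_type.
HB.instance Definition _ :=
  isPointed.Build hull_type (exist _ _ (hull_weighted 0)).

Definition hull_dist (x y : hull_type) : R :=
  sup (range (fun n => `|sval x n - sval y n|)).

Lemma hull_bounded (x : hull_type) : exists c, forall n, `|sval x n| <= c.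
Proof.
have [z zx] := svalP x _ ltr01; exists (1 + `|z|) => n.
rewrite -(subrK (weighted z n) (sval x n)) (le_trans (ler_normD _ _))//.
by rewrite lerD// weighted_le.
Qed.

Lemma hull_distP (x y : hull_type) (c : R) :
  hull_dist x y <= c <-> forall n, `|sval x n - sval y n| <= c.
Proof.
split=> [xyc n|xyc]; last first.
  apply: ge_sup => [|_ [n _ <-]//].
  by exists `|sval x 0%N - sval y 0%N|, 0%N.
apply: le_trans xyc; apply: ub_le_sup; last by exists n.
have [cx xcx] := hull_bounded x; have [cy ycy] := hull_bounded y.
exists (cx + cy) => _ [k _ <-].
by rewrite (le_trans (ler_normB _ _))// lerD.
Qed.

Lemma hull_dist_ge (x y : hull_type) n :
  `|sval x n - sval y n| <= hull_dist x y.
Proof. exact: (hull_distP x y _).1. Qed.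

Lemma hull_distxx x : hull_dist x x = 0.
Proof.
apply/eqP; rewrite eq_le; apply/andP; split.
  by apply/hull_distP => n; rewrite subrr normr0.
by apply: le_trans (hull_dist_ge x x 0); exact: normr_ge0.
Qed.

Lemma hull_ext (x y : hull_type) : (forall n, sval x n = sval y n) -> x = y.
Proof.
case: x y => [x hx] [y hy] /= xy; apply: eq_exist; exact/funext.
Qed.

Lemma hull_dist_positivity x y : hull_dist x y = 0 -> x = y.
Proof.
move=> xy; apply: hull_ext => n.
by apply/eqP; rewrite -subr_eq0 -normr_le0 -xy hull_dist_ge.
Qed.

Lemma hull_dist_sym x y : hull_dist x y = hull_dist y x.
Proof.
rewrite /hull_dist; under eq_fun do rewrite distrC.
by [].
Qed.

Lemma hull_dist_triangle y x z :
  hull_dist x z <= hull_dist x y + hull_dist y z.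
Proof.
apply/hull_distP => n; rewrite (le_trans (ler_distD (sval y n) _ _))//.
by rewrite lerD// hull_dist_ge.
Qed.

HB.instance Definition _ := isMetric.Build R hull_type
  hull_distxx hull_dist_positivity hull_dist_sym hull_dist_triangle.

Lemma hull_open_subball (O : set hull_type) (x : hull_type) : open O -> O x ->
  exists2 e, 0 < e & forall y, hull_dist x y < e -> O y.
Proof. exact: metric_open_subball. Qed.

Lemma hull_ball_open (x : hull_type) e : open [set y | hull_dist x y < e].
Proof. exact: (metric_ball_open x). Qed.

Lemma coordinate_continuous n : continuous (fun x : hull_type => sval x n).
Proof.
move=> x A /nbhs_ballP[e /= e0 eA]; apply/nbhs_ballP; exists e => //= y.
rewrite ballEmdist /= => xy; apply: eA; rewrite -ball_normE /=.
by apply: le_lt_trans xy; exact: hull_dist_ge.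
Qed.

Lemma hull_complete : complete_metric (hull_type : metricType R).
Proof.
move=> G PG cG.
have cauchyG e : 0 < e -> exists x : hull_type, G [set y | hull_dist x y < e].
  move=> e0; have /cauchy_ballP cb := cG.
  have [[A B] /= [GA GB] AB] := cb e e0.
  have [x Ax] := filter_ex GA; exists x; apply: filterS GB => y By.
  by have := AB (x, y) (conj Ax By); rewrite /= ballEmdist.
have /choice[l lP] n : exists l : R, sval x n @[x --> G] --> l.
  apply/cvg_ex; apply: cauchy_cvg; apply: cauchy_exP => e /cauchyG[x Gx].
  exists (sval x n).
  suff : G ((fun y => sval y n) @^-1` ball (sval x n) e) by [].
  apply: filterS Gx => y /= xy.
  by rewrite -ball_normE /=; apply: le_lt_trans xy; exact: hull_dist_ge.
have limit x e n : G [set y | hull_dist x y < e] -> `|sval x n - l n| <= e.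
  move=> Gx; apply/ler_addgt0Pr => r r0.
  have /cvgrPdist_lt /(_ r r0) Gl := lP n.
  have [y [/= xy ly]] := filter_ex (filterI Gx Gl).
  rewrite (le_trans (ler_distD (sval y n) _ _))// lerD//.
    by apply: le_trans (hull_dist_ge _ _ _) _; exact: ltW.
  by rewrite distrC ltW.
have hl : hull l.
  move=> e e0; have e20 : 0 < e / 2 by rewrite divr_gt0.
  have [x Gx] := cauchyG _ e20; have [z xz] := svalP x _ e20.
  exists z => n; rewrite (le_trans (ler_distD (sval x n) _ _))// (splitr e).
  by rewrite lerD// distrC limit.
exists (exist _ l hl) => A /nbhs_ballP[e /= e0 eA].
have e20 : 0 < e / 2 by rewrite divr_gt0.
have [x Gx] := cauchyG _ e20; apply: (filterS _ Gx) => y /= xy; apply: eA.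
rewrite ballEmdist /= (le_lt_trans (hull_dist_triangle x _ _))// (splitr e).
rewrite ler_ltD//; apply/hull_distP => n; rewrite distrC /=.
exact: limit.
Qed.

Definition translate (z : Z) (x : hull_type) : hull_type :=
  exist _ _ (hull_translate z (svalP x)).

Lemma translate0 x : translate 0 x = x.
Proof.
by apply: hull_ext => n; rewrite /= weighted0 addr0.
Qed.

Lemma translateD g h x : translate (g + h) x = translate g (translate h x).
Proof.
apply: hull_ext => n /=.
by rewrite weightedD addrAC addrA.
Qed.

Lemma translate_continuous :
  continuous (fun p : Z * hull_type => translate p.1 p.2).
Proof.
move=> [z x] A /nbhs_ballP[e /= e0 eA].
have e20 : 0 < e / 2 by rewrite divr_gt0.
exists (ball z (e / 2), ball x (e / 2)) => /=; first by split; exact: nbhsx_ballx.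
move=> [z' x'] [/= zz' xx']; apply: eA; move: zz' xx'.
rewrite -ball_normE !ballEmdist /= => zz' xx'; rewrite (splitr e).
apply: le_lt_trans (ltrD xx' zz'); apply/hull_distP => n /=.
rewrite opprD addrACA -weightedB (le_trans (ler_normD _ _))//.
by rewrite lerD ?weighted_le// hull_dist_ge.
Qed.

Lemma hull_separable : separable Z -> separable hull_type.
Proof.
move=> [A cA dA].
pose emb z : hull_type := exist _ _ (hull_weighted z).
exists (emb @` A); first exact: sub_countable (card_image_le _ _) cA.
move=> O [x Ox] oO; have [e e0 eO] := hull_open_subball oO Ox.
have e30 : 0 < e / 3 by rewrite divr_gt0.
have [z xz] := svalP x _ e30.
have [|a [za Aa]] := dA _ _ (ball_open z (e / 3)).
  by exists z; exact: ballxx.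
exists (emb a); split; last by exists a.
apply: eO; apply: (@le_lt_trans _ _ (e / 3 + e / 3)); last first.
  by rewrite -mulrDl ltr_pdivrMr// -mulr_natr mulrC; lra.
apply/hull_distP => n /=.
rewrite (le_trans (ler_distD (weighted z n) _ _))// lerD// -weightedB.
apply: le_trans (weighted_le _ _) _.
by move: za; rewrite -ball_normE /= => /ltW.
Qed.

Lemma translate_orbits_dense (x : hull_type) O :
  open O -> O !=set0 -> exists z, O (translate z x).
Proof.
move=> oO [y Oy]; have [e e0 eO] := hull_open_subball oO Oy.
have e30 : 0 < e / 3 by rewrite divr_gt0.
have [z xz] := svalP x _ e30; have [z' yz'] := svalP y _ e30.
exists (z' - z); apply: eO; apply: (@le_lt_trans _ _ (e / 3 + e / 3)); last by lra.
apply/hull_distP => n /=; rewrite weightedB.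
rewrite (_ : _ - _ = (sval y n - weighted z' n) - (sval x n - weighted z n)).
  by rewrite (le_trans (ler_normB _ _))// lerD.
by ring.
Qed.

(** Balls are convex along segments of orbits. *)
Lemma hull_convex_base (O : set hull_type) : open O -> O !=set0 ->
  exists O', [/\ open O', O' !=set0, O' `<=` O & forall x z t,
    0 <= t <= 1 -> O' x -> O' (translate z x) -> O' (translate (t *: z) x)].
Proof.
move=> oO [y Oy]; have [e e0 eO] := hull_open_subball oO Oy.
exists [set w | hull_dist y w < e]; split.
- exact: hull_ball_open.
- by exists y; rewrite /= hull_distxx.
- by move=> w; exact: eO.
move=> x z t /andP[t0 t1] /= yx yxz.
pose c := Num.max (hull_dist y x) (hull_dist y (translate z x)).
apply: (@le_lt_trans _ _ c); last by rewrite gt_max yx.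
apply/hull_distP => n /=; rewrite weightedZ.
rewrite (_ : _ - _ = (1 - t) * (sval y n - sval x n) +
    t * (sval y n - (sval x n + weighted z n))); last by ring.
rewrite (le_trans (ler_normD _ _))// !normrM.
rewrite (ger0_norm t0) (ger0_norm (_ : 0 <= 1 - t)) ?subr_ge0//.
rewrite -[leRHS](_ : (1 - t) * c + t * c = c); last by ring.
rewrite lerD// ler_wpM2l ?subr_ge0// le_max.
  by rewrite hull_dist_ge.
by have := hull_dist_ge y (translate z x) n => /= ->; rewrite orbT.
Qed.

End Hull.

(** * Size and complexity of the orbits *)

(** Otherwise [Z] would be spanned by at most [m] vectors: modulo them every
    vector lies in the common kernel of the first [m] functionals. *)
Lemma common_kernel_nontrivial (R : fieldType) (Z : lmodType R)
    (phi : nat -> {scalar Z}) (m : nat) : infinite_dimensional Z ->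
  exists2 z : Z, z != 0 & forall i, (i < m)%N -> phi i z = 0.
Proof.
move=> Zinf; apply: contrapT => none; apply: Zinf.
suff [k [e eP]] : exists (k : nat) (e : 'I_k -> Z), forall v,
    exists c : 'I_k -> R, forall i, (i < m)%N ->
      phi i (v - \sum_(j < k) c j *: e j) = 0.
  exists k, e => v; have [c cP] := eP v; exists c.
  apply/eqP; rewrite -subr_eq0; apply/negPn/negP => nz.
  by apply: none; exists (v - \sum_(j < k) c j *: e j).
elim: m {none} => [|m [k [e eP]]].
  by exists 0%N, (fun=> 0) => v; exists (fun=> 0).
have [[u phiu um]|none] := pselect (exists2 u,
    forall i, (i < m)%N -> phi i u = 0 & phi m u != 0); last first.
  exists k, e => v; have [c cP] := eP v; exists c => i.
  rewrite ltnS leq_eqVlt => /predU1P[->|]; last exact: cP.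
  by apply/eqP/negPn/negP => nz; apply: none; eexists; last exact: nz.
pose cons T (a : T) (s : 'I_k -> T) (j : 'I_k.+1) :=
  if unlift ord0 j is Some i then s i else a.
exists k.+1, (cons _ u e) => v; have [c cP] := eP v.
pose w := v - \sum_(j < k) c j *: e j.
exists (cons _ (phi m w / phi m u) c) => i im.
rewrite big_ord_recl /cons unlift_none.
under eq_bigr do rewrite liftK.
rewrite addrC opprD addrAC -addrA -/w [phi i _]linearD linearN linearZ /=.
move: im; rewrite ltnS leq_eqVlt => /predU1P[->|im].
  by rewrite divfK// addNr.
by rewrite (phiu i im) mulr0 oppr0 add0r cP.
Qed.

Lemma borel_setC (T : topologicalType) (A : set T) :
  borel_set A -> borel_set (~` A).
Proof. by rewrite -setTD; exact: sigma_algebraCD. Qed.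

Lemma borel_bigcap (T : topologicalType) (A : nat -> set T) :
  (forall n, borel_set (A n)) -> borel_set (\bigcap_n A n).
Proof.
move=> bA; rewrite -(setCK (\bigcap_n A n)) setC_bigcap.
by apply: borel_setC; apply: sigma_algebra_bigcup => n; exact: borel_setC.
Qed.

Section Orbits.
Variables (R : realType) (Z : completeNormedModType R).
Variable phi : norming_family Z.
Let X := hull_type phi.

Lemma box_open (w : X) (n : nat) (c : R) :
  open [set y : X | c < `|(sval y n - sval w n) * 2 ^+ n|].
Proof.
pose f (y : X) : R := `|(sval y n - sval w n) * 2 ^+ n|.
have fc : continuous f.
  move=> y; have yc := @coordinate_continuous _ _ phi n y.
  exact: cvg_norm (cvgM (cvgB yc (cvg_cst _)) (cvg_cst _)).
by apply: (@open_comp _ _ f [set r | c < r]) => [y _|]; [exact: fc|exact: open_gt].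
Qed.

(** Every orbit is covered by the boxes [|y n - w n| <= N / 2 ^+ n], which are
    closed; they have empty interior since translation by a long vector killed by
    the first [m] functionals moves [y] by very little, yet out of the box. *)
Lemma translate_orbits_meager (w : X) : infinite_dimensional Z ->
  generic_in setT [set y : X | ~ exists z, y = translate z w].
Proof.
move=> Zinf; exists (fun N => \bigcup_n
  [set y : X | N%:R < `|(sval y n - sval w n) * 2 ^+ n|]); split.
- move=> N; apply: bigcup_open => n _; exact: box_open.
- move=> N W oW _ [y Wy]; apply: contrapT => none.
  have inbox y' : W y' -> forall n, `|(sval y' n - sval w n) * 2 ^+ n| <= N%:R.
    move=> Wy' n; rewrite leNgt; apply/negP => h.
    by apply: none; exists y'; split=> //; exists n.
  have [e e0 eW] := hull_open_subball oW Wy.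
  have [m me] : exists m, N.*2.+1%:R / 2 ^+ m < e.
    exists (Num.truncn (N.*2.+1%:R / e)).+1.
    rewrite ltr_pdivrMr ?exprn_gt0// mulrC -ltr_pdivrMr//.
    rewrite (lt_trans (truncnS_gt _))// -natrX ltr_nat.
    exact: ltn_expl.
  have [z0 z0nz z0ker] := common_kernel_nontrivial phi m Zinf.
  pose z := (N.*2.+1%:R / `|z0|) *: z0.
  have zn : `|z| = N.*2.+1%:R.
    by rewrite normrZ normrM normfV normr_nat normr_id divfK// normr_eq0.
  have Wyz : W (translate z y).
    apply: eW; apply: le_lt_trans me; apply/hull_distP => n /=.
    rewrite opprD addNKr normrN; have [nm|mn] := ltnP n m.
      by rewrite /weighted linearZ /= z0ker// mulr0 mul0r normr0 divr_ge0.
    apply: le_trans (weighted_le_pow _ _ _) _; rewrite zn ler_wpM2l//.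
    by rewrite lef_pV2 ?posrE ?exprn_gt0// ler_weXn2l// ler1n.
  have : `|z| <= N.*2%:R.
    apply: (@functional_norming _ _ phi) => n.
    have -> : phi n z = (sval (translate z y) n - sval w n) * 2 ^+ n
        - (sval y n - sval w n) * 2 ^+ n.
      rewrite -mulrBl /= [sval y n + _]addrC opprB addrA subrK addrK.
      by rewrite /weighted divfK// expf_neq0.
    rewrite (le_trans (ler_normB _ _))// -addnn natrD lerD//; exact: inbox.
  by rewrite zn ler_nat ltnn.
move=> y [_ yP] [z yz].
have [n _ /=] := yP (Num.truncn `|z|).+1 I.
rewrite yz /= addrC addKr /weighted divfK ?expf_neq0// ltNge.
by rewrite (le_trans (functional_le _ _ _))// ltW// truncnS_gt.
Qed.

(** Since the functionals are norming, [weighted] is an isometry for the norm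
    [sup_n 2 ^+ n * `|x n|] on sequences, so its range is complete, that is,
    equal to the set of all sequences approximable from a dense subset; this
    is a countable condition. *)
Lemma translateP (d : nat -> Z) (x y : X) :
  (forall O, open O -> O !=set0 -> exists n, O (d n)) ->
  (exists z, y = translate z x) <->
  forall k, exists m, forall n,
    `|(sval y n - sval x n) * 2 ^+ n - phi n (d m)| <= k.+1%:R^-1.
Proof.
move=> dd; split=> [[z ->] k|approx].
  have [m zm] : exists m, ball z k.+1%:R^-1 (d m).
    apply: dd; first exact: ball_open.
    by exists z; apply: ballxx; rewrite invr_gt0.
  exists m => n; move: zm; rewrite -ball_normE /= => /ltW; apply: le_trans.
  rewrite [sval x n + _]addrC addrK /weighted divfK ?expf_neq0// -linearB.
  exact: functional_le.
have [m mP] := choice approx.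
have md k l : `|d (m k) - d (m l)| <= k.+1%:R^-1 + l.+1%:R^-1.
  apply: (@functional_norming _ _ phi) => n; rewrite linearB /=.
  rewrite (le_trans (ler_distD ((sval y n - sval x n) * 2 ^+ n) _ _))//.
  by rewrite lerD// distrC.
have [z dz] : exists z : Z, d (m k) @[k --> \oo] --> z.
  apply/cvg_ex; apply: cauchy_cvg; apply: cauchy_exP => e e0.
  pose K := Num.truncn (2 / e).
  have Ke : K.+1%:R^-1 < e / 2.
    by rewrite invf_plt ?posrE ?divr_gt0// invf_div truncnS_gt.
  exists (d (m K)), K => // k /= Kk; rewrite -ball_normE /=.
  rewrite (le_lt_trans (md K k))// (splitr e) ltrD// (le_lt_trans _ Ke)//.
  by rewrite lef_pV2 ?posrE// ler_nat.
exists z; apply: hull_ext => n /=.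
suff -> : weighted phi z n = sval y n - sval x n by rewrite addrC subrK.
suff zE : phi n z = (sval y n - sval x n) * 2 ^+ n.
  by rewrite /weighted zE mulfK// expf_neq0.
apply/eqP; rewrite -subr_eq0 -normr_le0; apply/ler_addgt0Pr => e e0.
have e20 : 0 < e / 2 by rewrite divr_gt0.
pose K := Num.truncn (e / 2)^-1.
have Ke : K.+1%:R^-1 < e / 2 by rewrite invf_plt ?posrE// truncnS_gt.
have /cvgrPdist_lt /(_ _ e20) [N _ NP] := dz.
have := NP (maxn N K) (leq_maxl _ _) => /= zd.
rewrite add0r (le_trans (ler_distD (phi n (d (m (maxn N K)))) _ _))//.
rewrite (splitr e) lerD//.
  rewrite -linearB; apply: le_trans (functional_le _ _ _) _; exact: ltW.
rewrite distrC (le_trans (mP (maxn N K) n))// (le_trans _ (ltW Ke))//.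
by rewrite lef_pV2 ?posrE// ler_nat ltnS leq_maxr.
Qed.

Lemma translate_orbits_borel : separable Z ->
  borel_set [set p : X * X | exists z, p.2 = translate z p.1].
Proof.
move=> /(separable_dense_seq 0)[d dd].
pose C k m := \bigcap_n [set p : X * X |
  `|(sval p.2 n - sval p.1 n) * 2 ^+ n - phi n (d m)| <= k.+1%:R^-1].
rewrite (_ : [set p | _] = \bigcap_k \bigcup_m C k m); last first.
  apply/seteqP; split=> -[x y] /=.
    move=> /(translateP _ _ dd) xy k _.
    by have [m mP] := xy k; exists m => // n _; exact: mP.
  move=> xy; apply/(translateP _ _ dd) => k.
  by have [m _ mP] := xy k I; exists m => n; exact: mP.
have cC k m : closed (C k m).
  apply: closed_bigI => n _.
  pose f (p : X * X) : R :=
    `|(sval p.2 n - sval p.1 n) * 2 ^+ n - phi n (d m)|.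
  have fc : continuous f.
    move=> p.
    have c1 : (fun p : X * X => sval p.1 n) @ p --> sval p.1 n.
      apply: (@continuous_comp _ _ _ fst (fun x : X => sval x n)).
        exact: cvg_fst.
      exact: coordinate_continuous.
    have c2 : (fun p : X * X => sval p.2 n) @ p --> sval p.2 n.
      apply: (@continuous_comp _ _ _ snd (fun x : X => sval x n)).
        exact: cvg_snd.
      exact: coordinate_continuous.
    exact: cvg_norm (cvgB (cvgM (cvgB c2 c1) (cvg_cst _)) (cvg_cst _)).
  apply: (@preimage_closed _ _ f [set r | r <= k.+1%:R^-1]).
    by move=> p _; exact: fc.
  exact: closed_le.
apply: borel_bigcap => k; apply: sigma_algebra_bigcup => m.
rewrite -(setCK (C k m)); apply: borel_setC.
by apply: sub_sigma_algebra; exact: closed_openC.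
Qed.

End Orbits.

Theorem theorem1p4 (R : realType) (Z : completeNormedModType R)
    (Zsep : separable Z) (Zinf : infinite_dimensional Z) :
  exists (X : ptopologicalType) (act : Z -> X -> X),
    [/\ polish_Gspace R act,
        borel_set [set p : X * X | orbit_equivalence act p.1 p.2]
      & ~ essentially_countable R
            (orbit_equivalence act : borelType X -> borelType X -> Prop)].
Proof.
have [phi] := norming_family_exists Zsep.
have complete := hull_complete (phi := phi).
exists (hull_type phi), (@translate _ _ phi); split.
- split.
  + split; first exact: hull_separable.
    exists (hull_type phi), id, id; split=> // x; exact: cvg_id.
  + exact: translate0.
  + exact: translateD.
  + exact: translate_continuous.
- rewrite (_ : [set p | _] = [set p | exists z, p.2 = translate z p.1]).
    exact: translate_orbits_borel.
  apply/funext => -[x y]; apply/propext; apply: orbit_equivalenceP.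
    exact: translate0.
  exact: translateD.
apply: turbulent_not_essentially_countable => //.
- exact: complete_metric_baire.
- exact: translate0.
- exact: translateD.
- exact: translate_continuous.
- exact: translate_orbits_dense.
- exact: hull_convex_base.
- by move=> x; exact: translate_orbits_meager.
Qed.
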